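(* For every $\lambda>0$ there exists $N$ such that for all integers $n\ge N$, $$\sup\bigl\{C_\lambda(A)\ \big|\ A\subset\mathbb{R}^n,\ \operatorname{diam}(A)\le 1\bigr\}>C_\lambda\bigl(B^{(n)}_{1/2}\bigr),$$ where $B^{(n)}_{1/2}=\{x\in\mathbb{R}^n:|x|\le\tfrac12\}$.
   Context: For $\lambda\in(0,n)$ and a set $A\subset\mathbb{R}^n$, the $\lambda$-capacity of $A$ is $$C_\lambda(A)=\Bigl(\inf\bigl\{I_\lambda(\nu)\ \big|\ \nu\in\mathcal{P},\ \operatorname{supp}\nu\subset A\bigr\}\Bigr)^{-1},\qquad I_\lambda(\nu)=\int_{\mathbb{R}^n}\int_{\mathbb{R}^n}|x-y|^{-\lambda}\,d\nu(x)\,d\nu(y),$$ where $\mathcal{P}$ is the set of Borel probability measures on $\mathbb{R}^n$, $|x-y|^{-\lambda}=+\infty$ if $x=y$, and $C_\lambda(A)=0$ if the infimum is $+\infty$. The dimensions considered satisfy $n>\lambda$. *)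

(* Defs.v *)
From HB Require Import structures.
From mathcomp Require Import all_boot all_order all_algebra.
From mathcomp Require Import all_classical all_reals all_analysis.

Set Implicit Arguments.
Unset Strict Implicit.
Unset Printing Implicit Defensive.

Import Order.TTheory GRing.Theory Num.Theory.
Import numFieldNormedType.Exports.

Local Open Scope classical_set_scope.
Local Open Scope ring_scope.

(* The library norm `|x| on 'rV[R]_n is the sup norm, which induces the same
   open sets as l2norm; the Borel sets below are thus the usual ones. *)
Definition l2norm (R : realType) (n : nat) (x : 'rV[R]_n) : R :=
  Num.sqrt (\sum_(i < n) x ord0 i ^+ 2).

Notation borel_rV R n := (g_sigma_algebraType (@open 'rV[R]_n)).

Definition msupport (R : realType) (n : nat)
    (nu : probability (borel_rV R n) R) : set 'rV[R]_n :=
  [set x | forall U : set 'rV[R]_n, open U -> U x -> (0 < nu U)%E].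

(* The case split is needed since 0 `^ (- lambda) = 0 when lambda != 0. *)
Definition riesz_kernel (R : realType) (n : nat) (lambda : R)
    (x y : 'rV[R]_n) : \bar R :=
  if x == y then +oo%E else (l2norm (x - y) `^ (- lambda))%:E.

Definition riesz_energy (R : realType) (n : nat) (lambda : R)
    (nu : probability (borel_rV R n) R) : \bar R :=
  (\int[nu]_x \int[nu]_y riesz_kernel lambda x y)%E.

(* In \bar R, +oo^-1 = 0 and 0^-1 = +oo; the infimum is +oo when no measure is
   admissible (A = set0). *)
Definition capacity (R : realType) (n : nat) (lambda : R)
    (A : set 'rV[R]_n) : \bar R :=
  ((ereal_inf [set riesz_energy lambda nu |
      nu in [set nu : probability (borel_rV R n) R | msupport nu `<=` A]])^-1)%E.

(* diam set0 = -oo. *)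
Definition diam (R : realType) (n : nat) (A : set 'rV[R]_n) : \bar R :=
  ereal_sup [set (l2norm (x - y))%:E | x in A & y in A].

Definition l2ball (R : realType) (n : nat) (r : R) : set 'rV[R]_n :=
  [set x | l2norm x <= r].
Arguments l2ball {R} n r.

(* Main.v *)
(* Upper bound for the ball: two independent points drawn from a measure on the
   ball of radius 1/2 have mean square distance at most 1/2, so by convexity of
   t |-> t^(-lambda/2) the energy is at least 2^(lambda/2), in every dimension.

   Lower bound for a simplex: the vertices of a simplex of edge nearly 1 in R^n
   are almost all at distance nearly 1 from each other, and this survives when
   each vertex is replaced by a tiny copy of the simplex, and so on. The random
   point sum_j w_j v_(d_j), where the d_j are the base-n digits of a uniform
   t in [0, 1], v_i = e_i and w_j = c 10^(-j), lies in
   {x_i >= 0, sum x_i <= 7/10}, of diameter at most 1. Two such points whose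
   digits first differ at rank k (probability at most n^(-k)) are at distance
   at least (3/4) 10^(-k), so the energy is at most
   (4/3)^lambda / (1 - 10^lambda / n), which for large n is below 2^(lambda/2)
   because 4/3 < sqrt 2. *)

Require Import Defs.
From HB Require Import structures.
From mathcomp Require Import all_boot all_order all_algebra.
From mathcomp Require Import all_classical all_reals all_analysis.
From mathcomp Require Import measurable_realfun ring lra zify.

Set Implicit Arguments.
Unset Strict Implicit.
Unset Printing Implicit Defensive.

Import Order.TTheory GRing.Theory Num.Theory.
Import numFieldNormedType.Exports.

Local Open Scope classical_set_scope.
Local Open Scope ring_scope.

(* The integral is defined, for an arbitrary function, from the suprema of the
   integrals of the simple functions below its positive and negative parts.
   Working without measurability hypotheses spares the joint measurability of
   the kernel. *)
Section integral_without_measurability.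
Local Open Scope ereal_scope.
Context d (T : measurableType d) (R : realType).
Import HBNNSimple.

Lemma ge0_le_integral_setT (mu : {measure set T -> \bar R}) (f g : T -> \bar R) :
  (forall x, 0 <= f x) -> (forall x, f x <= g x) ->
  \int[mu]_x f x <= \int[mu]_x g x.
Proof.
move=> f0 fg; rewrite !ge0_integralTE//; last first.
  by move=> x; exact: le_trans (f0 x) (fg x).
apply: ereal_sup_le => _ [h hf <-].
by exists h => // x; exact: le_trans (hf x) (fg x).
Qed.

Lemma le_integral_setT (mu : {measure set T -> \bar R}) (f g : T -> \bar R) :
  (forall x, f x <= g x) -> \int[mu]_x f x <= \int[mu]_x g x.
Proof.
move=> fg; rewrite integralE [leRHS]integralE; apply: leeB.
  apply: ge0_le_integral_setT => // x.
  by apply: (@funepos_le _ _ setT f g) => //; rewrite in_setT.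
apply: ge0_le_integral_setT => // x.
by apply: (@funeneg_le _ _ setT f g) => //; rewrite in_setT.
Qed.

(** A simple function [h] below [f] yields the simple function [h \o X] below [f \o X]. Only an
    inequality results: [f \o X] may also dominate simple functions that do not factor through
    [X]. *)
Lemma pushforward_integral_le d' (T' : measurableType d')
    (mu : {measure set T -> \bar R}) (X : {mfun T >-> T'}) (f : T' -> \bar R) :
  (forall y, 0 <= f y) ->
  \int[pushforward mu X]_y f y <= \int[mu]_x f (X x).
Proof.
move=> f0; rewrite [leLHS]ge0_integralTE//; apply: ge_ereal_sup => _ [h hf <-].
have -> : sintegral (pushforward mu X) h = \int[pushforward mu X]_y (h y)%:E.
  by rewrite integral_nnsfun// patch_setT.
rewrite ge0_integral_pushforward//=.
- rewrite preimage_setT; apply: ge0_le_integral_setT => x; last exact: hf.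
  by rewrite lee_fin.
- exact/measurable_EFinP.
- by move=> y _; rewrite lee_fin.
Qed.

End integral_without_measurability.

(** * Euclidean norm, Borel sets and supports *)

Section l2norm.
Context (R : realType) (n : nat).
Implicit Types x y : 'rV[R]_n.

Lemma sqr_l2norm x : l2norm x ^+ 2 = \sum_(i < n) x ord0 i ^+ 2.
Proof. by rewrite sqr_sqrtr// sumr_ge0// => i _; exact: sqr_ge0. Qed.

Lemma continuous_coord_sum (f : R -> R) : continuous f ->
  continuous (fun x : 'rV[R]_n => \sum_(i < n) f (x ord0 i)).
Proof.
move=> cf; apply: continuous_big => [|i _ x]; first exact: add_continuous.
by apply: continuous_comp; [exact: coord_continuous|exact: cf].
Qed.

Lemma l2norm_continuous : continuous (@l2norm R n).
Proof.
move=> x; apply: (@continuous_comp _ _ _ _ Num.sqrt).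
  by apply: (@continuous_coord_sum (fun t => t ^+ 2)); exact: exprn_continuous.
exact: sqrt_continuous.
Qed.

Lemma closed_l2ball (r : R) : closed (l2ball n r).
Proof.
apply: (@preimage_closed _ _ (@l2norm R n) [set t | t <= r]).
  by move=> x _; exact: l2norm_continuous.
exact: closed_le.
Qed.

Lemma open_measurable_rV (A : set 'rV[R]_n) :
  open A -> measurable (A : set (borel_rV R n)).
Proof. by move=> oA; exact: sub_sigma_algebra. Qed.

Lemma closed_measurable_rV (A : set 'rV[R]_n) :
  closed A -> measurable (A : set (borel_rV R n)).
Proof.
move=> cA; rewrite -[A]setCK; apply: (@measurableC _ (borel_rV R n)).
by apply: open_measurable_rV; exact: closed_openC.
Qed.

Lemma continuous_measurable_rV (f : 'rV[R]_n -> R) : continuous f ->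
  measurable_fun setT (f : borel_rV R n -> R).
Proof.
move=> cf; apply: (measurability _ (RGenOpens.measurableE R)).
move=> _ [_ [a [b ->] <-]]; rewrite setTI; apply: open_measurable_rV.
by apply: open_comp => //; exact: interval_open.
Qed.

(** Each point of [K] has a null open neighbourhood, and finitely many of these cover [K]. *)
Lemma compact_null_outside_msupport (nu : probability (borel_rV R n) R)
  (K : set 'rV[R]_n) : compact K -> K `&` msupport nu = set0 -> nu K = 0%E.
Proof.
move=> cK Ksupp.
have mK : measurable (K : set (borel_rV R n)).
  by apply: closed_measurable_rV; exact: compact_closed.
have oU : forall U, (fun U : set 'rV[R]_n => open U /\ nu U = 0%E) U -> open (idfun U).
  by move=> U [].
have Kcov : K `<=` cover (fun U : set 'rV[R]_n => open U /\ nu U = 0%E) idfun.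
  move=> x Kx; have : ~ msupport nu x.
    by move=> sx; have : (K `&` msupport nu) x by []; rewrite Ksupp.
  move=> /existsNP[U /not_implyP[oU0 /not_implyP[Ux /negP nuU]]].
  exists U => //; split => //; apply/eqP; rewrite eq_le measure_ge0 andbT.
  by rewrite leNgt.
move: cK; rewrite compact_cover => /(_ _ _ _ oU Kcov)[D DU KD].
have : nu.-negligible (K : set (borel_rV R n)).
  refine (@negligibleS _ (borel_rV R n) R nu _ _ KD _); rewrite /cover bigcup_fset.
  rewrite big_seq; elim/big_ind : _ => [|A B|U /DU].
  - exact: negligible_set0.
  - exact: negligibleU.
  - rewrite inE => -[oU0 nuU]; apply/negligibleP => //.
    exact: open_measurable_rV.
by move/negligibleP => /(_ mK).
Qed.

(** The complement of the ball is a countable union of compact sets, each missing the support and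
    hence null. *)
Lemma l2ball_full (nu : probability (borel_rV R n) R) (r : R) :
  msupport nu `<=` l2ball n r -> nu (l2ball n r) = 1%E.
Proof.
move=> supp_ball.
pose K m : set 'rV[R]_n :=
  [set x | `|x| <= m%:R] `&` [set x | r + m.+1%:R^-1 <= l2norm x].
have cK m : closed (K m).
  apply: closedI.
    apply: (@preimage_closed _ _ (fun x : 'rV[R]_n => `|x|) [set t | t <= m%:R]).
      by move=> x _; exact: norm_continuous.
    exact: closed_le.
  apply: (@preimage_closed _ _ (@l2norm R n) [set t | r + m.+1%:R^-1 <= t]).
    by move=> x _; exact: l2norm_continuous.
  exact: closed_ge.
have nuK m : nu (K m) = 0%E.
  apply: compact_null_outside_msupport.
    apply: bounded_closed_compact => //.
    exists m%:R; split => // M mM x [xm _] /=.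
    exact: le_trans (ltW mM).
  rewrite -subset0 => x [[_ /= rx] /supp_ball]; rewrite /l2ball/= => xr.
  have := le_trans rx xr; rewrite gerDl leNgt invr_gt0.
  by rewrite ltr0n.
have mball : measurable (l2ball n r : set (borel_rV R n)).
  by apply: closed_measurable_rV; exact: closed_l2ball.
apply/eqP; rewrite -[X in nu X]setCK probability_setC; last exact: measurableC.
suff -> : nu (~` l2ball n r) = 0%E by rewrite sube0.
apply/negligibleP; first exact: measurableC.
have nuUK : nu.-negligible (\bigcup_m K m : set (borel_rV R n)).
  apply: negligible_bigcup => m; apply/negligibleP; last exact: nuK.
  exact: closed_measurable_rV.
have sub : ~` l2ball n r `<=` \bigcup_m K m; last first.
  exact: (@negligibleS _ (borel_rV R n) R nu _ _ sub nuUK).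
move=> x /negP; rewrite /l2ball -ltNge => rx.
pose m := maxn (Num.truncn `|x|).+1 (Num.truncn (l2norm x - r)^-1).+1.
exists m => //; split => /=.
  rewrite (le_trans (ltW (truncnS_gt _)))// ler_nat; exact: leq_maxl.
rewrite -lerBrDl invf_ple ?posrE ?subr_gt0 ?ltr0n//.
rewrite (le_trans (ltW (truncnS_gt _)))// ler_nat.
by rewrite (leq_trans (leq_maxr (Num.truncn `|x|).+1 _)).
Qed.

End l2norm.

(** * Lower bound for the energy on the ball *)

Section ball_energy.
Context (R : realType).

(** Tangent line at [t = 1], obtained from [expR (- a * ln t) >= 1 - a * ln t] and
    [ln t <= t - 1]. *)
Lemma powR_tangent (a t : R) : 0 <= a -> 0 < t -> 1 - a * (t - 1) <= t `^ (- a).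
Proof.
move=> a0 t0; rewrite /powR gt_eqF//.
apply: le_trans (expR_ge1Dx _); rewrite mulNr lerD2l lerN2 ler_wpM2l//.
by rewrite lerBrDl (le_trans (expR_ge1Dx (ln t)))// lnK.
Qed.

Context (n : nat) (lambda : R) (lambda0 : 0 < lambda).
Implicit Types x y u : 'rV[R]_n.

Let B := l2ball n (2^-1 : R).

Lemma riesz_kernel_ge0 x y : (0 <= riesz_kernel lambda x y)%E.
Proof. by rewrite /riesz_kernel; case: ifP => // _; rewrite lee_fin powR_ge0. Qed.

Lemma l2norm_eq0 x : (l2norm x == 0) = (x == 0).
Proof.
rewrite -sqrf_eq0 sqr_l2norm psumr_eq0; last by move=> i _; exact: sqr_ge0.
apply/allP/eqP => [x0|-> i _]; last by rewrite mxE expr0n/=.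
apply/rowP => i; rewrite mxE; apply/eqP; rewrite -sqrf_eq0.
by apply: x0; rewrite mem_index_enum.
Qed.

(** On the ball the squared distance is at most [1/2 - 2 s], with [s] the inner product. The tangent
    is taken at squared distance [1/2], so the minorant is affine in each variable and its integral
    involves only the barycentre. *)
Lemma riesz_kernel_ge_affine x y : B x -> B y ->
  ((2 `^ (lambda / 2) * (1 + 2 * lambda * \sum_(i < n) x ord0 i * y ord0 i))%:E
    <= riesz_kernel lambda x y)%E.
Proof.
rewrite /B /l2ball /riesz_kernel/= => Bx By; case: eqP => [_|/eqP xy].
  exact: leey.
set s := \sum_(i < n) _; set a := lambda / 2.
have a0 : 0 <= a by rewrite divr_ge0// ltW.
pose t := l2norm (x - y); have t0 : 0 < t.
  by rewrite lt_def sqrtr_ge0 l2norm_eq0 subr_eq0 xy.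
have tE : t ^+ 2 = l2norm x ^+ 2 + l2norm y ^+ 2 - 2 * s.
  rewrite !sqr_l2norm mulr_sumr -big_split/= -sumrB.
  by apply: eq_bigr => i _; rewrite !mxE; ring.
have ball_sqr (z : 'rV[R]_n) : l2norm z <= 2^-1 -> l2norm z ^+ 2 <= 1/4.
  move=> zB; have z0 : 0 <= l2norm z by exact: sqrtr_ge0.
  by rewrite expr2 [leRHS](_ : _ = 2^-1 * 2^-1) ?ler_pM//; lra.
have t2le : t ^+ 2 <= 1/2 - 2 * s.
  by have := ball_sqr _ Bx; have := ball_sqr _ By; rewrite tE; lra.
have -> : t `^ (- lambda) = 2 `^ a * (2 * t ^+ 2) `^ (- a).
  rewrite powRM ?sqr_ge0// mulrA -powRD ?subrr ?pnatr_eq0 ?implybT//.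
  rewrite powRr0 mul1r -powR_mulrn ?ltW// -powRrM; congr (_ `^ _).
  by rewrite /a; field.
rewrite lee_fin ler_wpM2l ?powR_ge0//.
apply: le_trans (powR_tangent a0 _); last by rewrite mulr_gt0// exprn_gt0.
have -> : 2 * lambda * s = - (a * (- 4 * s)) by rewrite /a; field.
rewrite lerD2l lerN2 ler_wpM2l//; lra.
Qed.

(** The witness [b] is the barycentre of [nu]; the coordinates are integrable because they are
    bounded on the ball. *)
Lemma integral_ball_affine (nu : probability (borel_rV R n) R) :
  nu B = 1%E ->
  exists b : 'rV[R]_n, forall c u,
    (\int[nu]_(y in B) (c + \sum_(i < n) u ord0 i * y ord0 i)%:E =
     (c + \sum_(i < n) u ord0 i * b ord0 i)%:E)%E.
Proof.
move=> nuB.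
have mB : measurable (B : set (borel_rV R n)).
  by apply: closed_measurable_rV; exact: closed_l2ball.
have nuBoo : (nu B < +oo)%E by rewrite nuB ltry.
have intx i : nu.-integrable B (EFin \o (fun y : borel_rV R n => (y : 'rV[R]_n) ord0 i)).
  apply: measurable_bounded_integrable => //.
  - apply: measurable_funTS; apply: continuous_measurable_rV.
    exact: coord_continuous.
  - exists 2^-1; split => // M hM y By /=; apply: le_trans (ltW hM).
    apply: le_trans By; rewrite -(@ler_pXn2r _ 2%N) ?nnegrE ?sqrtr_ge0//.
    rewrite sqr_l2norm real_normK ?num_real// (bigD1 i)//= lerDl.
    by rewrite sumr_ge0// => j _; exact: sqr_ge0.
exists (\row_i fine (\int[nu]_(y in B) (y ord0 i)%:E)%E) => c u.
have intux i : nu.-integrable B (fun y => (u ord0 i)%:E * (y ord0 i)%:E)%E.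
  exact: (integrableZl mB (u ord0 i) (intx i)).
transitivity (\int[nu]_(y in B)
    (c%:E + \sum_(i < n) (u ord0 i)%:E * (y ord0 i)%:E))%E.
  apply: eq_integral => y _; rewrite EFinD -sumEFin; congr (_ + _)%E.
rewrite integralD//; last 2 first.
- apply: (@measurable_bounded_integrable _ _ _ _ (cst c)) => //.
  exists `|c|; split => // M hM y By /=; exact: ltW.
- exact: (@integrable_sum _ (borel_rV R n) R nu B mB _ _ xpredT
    (fun i y => (u ord0 i)%:E * (y ord0 i)%:E)%E (fun i _ => intux i)).
rewrite integral_cst// [X in (c%:E * X)%E]nuB mule1 EFinD; congr (_ + _)%E.
rewrite integral_sum// -sumEFin; apply: eq_bigr => i _.
rewrite (integralZl mB (intx i)) mxE EFinM fineK//.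
exact: (integrable_fin_num mB (intx i)).
Qed.

(* Jensen's inequality for [t |-> t `^ (- lambda / 2)]: two independent points
   of the ball are at mean square distance at most [1/2]. *)
Lemma ball_energy_ge (nu : probability (borel_rV R n) R) :
  msupport nu `<=` B -> ((2 `^ (lambda / 2))%:E <= riesz_energy lambda nu)%E.
Proof.
move=> /l2ball_full nuB; have [b bE] := integral_ball_affine nuB.
set D := 2 `^ (lambda / 2).
have D0 : 0 <= D by exact: powR_ge0.
have bb : 0 <= \sum_(i < n) b ord0 i * b ord0 i.
  by apply: sumr_ge0 => i _; rewrite -expr2 sqr_ge0.
(* This is the double integral of the affine minorant: [D] plus [2 * lambda * D] times the squared
   norm of the barycentre. *)
apply: (@le_trans _ _ (D + \sum_(i < n) ((2 * lambda * D) *: b) ord0 i * b ord0 i)%:E).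
  rewrite lee_fin lerDl; under eq_bigr do rewrite mxE -mulrA.
  by rewrite -mulr_sumr mulr_ge0// mulr_ge0// mulr_ge0// ltW.
rewrite -bE integral_mkcond; apply: le_integral_setT => x /=.
rewrite patchE; case: ifPn => [|_]; last first.
  by apply: integral_ge0 => y _; exact: riesz_kernel_ge0.
rewrite inE => Bx.
(* By symmetry of the inner product, the value at [x] is also the integral in [y] of the minorant
   with [x] fixed. *)
have -> : D + \sum_(i < n) ((2 * lambda * D) *: b) ord0 i * x ord0 i =
    D + \sum_(i < n) ((2 * lambda * D) *: x) ord0 i * b ord0 i.
  by congr (_ + _); apply: eq_bigr => i _; rewrite !mxE; ring.
rewrite -bE integral_mkcond; apply: le_integral_setT => y /=.
rewrite patchE; case: ifPn => [|_]; last exact: riesz_kernel_ge0.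
rewrite inE => By; apply: le_trans (riesz_kernel_ge_affine Bx By).
rewrite lee_fin -/D mulrDr mulr1 lerD2l mulr_sumr mulr_sumr.
by apply: ler_sum => i _; rewrite mxE; lra.
Qed.

End ball_energy.

(** * Points of the simplex coded by digit sequences *)

Section digit_points.
Context (R : realType).
Implicit Types a : nat -> R.

(* The weights add up to 7/10, just below 1 / sqrt 2, and each one exceeds the
   sum of the next ones by 56/100 * 10^(-j), where 56/100 * sqrt 2 > 3/4. *)
Definition weight (j : nat) : R := 63 / 100 * 10^-1 ^+ j.

Definition wsum a : R := limn (series (fun j => weight j * a j)).

Lemma weight_ge0 j : 0 <= weight j.
Proof. by rewrite mulr_ge0 ?exprn_ge0//; lra. Qed.

Lemma norm_wseries_le a k N : (forall j, `|a j| <= 1) ->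
  (forall j, (j < k)%N -> a j = 0) ->
  \sum_(0 <= j < N) `|weight j * a j| <= 7 / 10 * 10^-1 ^+ k.
Proof.
move=> a1 a0.
(* The strengthened bound telescopes, since [weight N] is 7/10 times
   [10^-1 ^+ N - 10^-1 ^+ N.+1]. *)
suff H : \sum_(0 <= j < N) `|weight j * a j| <=
    7 / 10 * (10^-1 ^+ k - 10^-1 ^+ maxn k N).
  apply: le_trans H _; rewrite ler_wpM2l ?gerBl ?exprn_ge0//; lra.
elim: N => [|N IHN].
  by rewrite big_nil maxn0 subrr mulr0.
rewrite big_nat_recr//=; have [Nk|kN] := ltnP N k.
  rewrite a0// mulr0 normr0 addr0 (le_trans IHN)//.
  by rewrite (maxn_idPl (ltnW Nk)) (maxn_idPl Nk).
apply: le_trans (lerD IHN (_ : _ <= weight N)) _.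
  by rewrite normrM ger0_norm ?weight_ge0// ler_piMr ?weight_ge0.
rewrite (maxn_idPr kN) (maxn_idPr (leqW kN)) /weight exprS; lra.
Qed.

Lemma is_cvg_wseries a : (forall j, `|a j| <= 1) ->
  cvgn (series (fun j => weight j * a j)).
Proof.
move=> a1; apply: normed_cvg; apply: nondecreasing_is_cvgn.
  by apply: nondecreasing_series => j _ _; exact: normr_ge0.
exists (7 / 10 * 10^-1 ^+ 0) => _ [N _ <-].
by apply: norm_wseries_le.
Qed.

Lemma norm_wsum_le a k : (forall j, `|a j| <= 1) ->
  (forall j, (j < k)%N -> a j = 0) -> `|wsum a| <= 7 / 10 * 10^-1 ^+ k.
Proof.
move=> a1 a0.
have bnd N : `|series (fun j => weight j * a j) N| <= 7 / 10 * 10^-1 ^+ k.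
  apply: le_trans (norm_wseries_le N a1 a0); exact: ler_norm_sum.
have cv := is_cvg_wseries a1.
rewrite ler_norml; apply/andP; split.
  by apply: limr_ge => //; apply: nearW => N; move: (bnd N); rewrite ler_norml => /andP[].
by apply: limr_le => //; apply: nearW => N; move: (bnd N); rewrite ler_norml => /andP[].
Qed.

(** The leading term 63/100 loses at most the tail 7/10 * 1/10, both in units of [10^-1 ^+ k], which
    leaves 56/100. *)
Lemma wsum_lead_ge a k : (forall j, `|a j| <= 1) ->
  (forall j, (j < k)%N -> a j = 0) -> a k = 1 ->
  56 / 100 * 10^-1 ^+ k <= wsum a.
Proof.
move=> a1 a0 ak; rewrite /wsum; apply: limr_ge; first exact: is_cvg_wseries.
near=> N; have kN : (k < N)%N by near: N; exact: nbhs_infty_gt.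
pose a' j := if j == k then 0 else a j.
have -> : series (fun j => weight j * a j) N =
    weight k + \sum_(0 <= j < N) weight j * a' j.
  rewrite /series/= !(bigD1_seq k) ?mem_index_iota ?iota_uniq//=.
  rewrite ak mulr1 /a' eqxx mulr0 add0r; congr (_ + _).
  by apply: eq_bigr => j /negbTE ->.
have H : \sum_(0 <= j < N) `|weight j * a' j| <= 7 / 10 * 10^-1 ^+ k.+1.
  apply: norm_wseries_le => j.
    by rewrite /a'; case: ifP => // _; rewrite normr0.
  by rewrite ltnS leq_eqVlt /a'; case: eqP => //= _ /a0.
have : - (7 / 10 * 10^-1 ^+ k.+1) <= \sum_(0 <= j < N) weight j * a' j.
  rewrite lerNl; apply: le_trans H; rewrite -sumrN; apply: ler_sum => j _.
  by rewrite -normrN ler_norm.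
rewrite /weight exprS; set q := _ ^+ k; lra.
Unshelve. all: by end_near. Qed.

Lemma wsumB a b : (forall j, `|a j| <= 1) -> (forall j, `|b j| <= 1) ->
  wsum a - wsum b = wsum (fun j => a j - b j).
Proof.
move=> /is_cvg_wseries ca /is_cvg_wseries cb; rewrite /wsum -limB//.
congr (limn _); apply/funext => N; rewrite !fctE /series/= -sumrB.
by apply: eq_bigr => j _; rewrite mulrBr.
Qed.

Context (n : nat).
Implicit Types e : nat -> nat.

(** The sum of [weight j] times the basis vector of index [e j], taken coordinatewise; an index
    [e j >= n] contributes nothing. *)
Definition digit_point e : 'rV[R]_n := \row_(i < n) wsum (fun j => (e j == i)%:R).

Let norm_digit e (i : nat) j : `|(e j == i)%:R : R| <= 1.
Proof. by case: eqP; rewrite ?normr1 ?normr0. Qed.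

Lemma digit_point_ge0 e i : 0 <= digit_point e ord0 i.
Proof.
rewrite mxE /wsum; apply: limr_ge; first exact/is_cvg_wseries/norm_digit.
by apply: nearW => N; apply: sumr_ge0 => j _; rewrite mulr_ge0 ?weight_ge0.
Qed.

(** Each rank gives its weight to at most one coordinate, and the weights add up to 7/10. *)
Lemma digit_point_sum_le e : \sum_(i < n) digit_point e ord0 i <= 7 / 10.
Proof.
under eq_bigr do rewrite mxE.
have cv : \sum_(i < n) series (fun j => weight j * (e j == i :> nat)%:R) N @[N --> \oo]
    --> \sum_(i < n) wsum (fun j => (e j == i :> nat)%:R).
  apply: cvg_big => [|i _]; first exact: add_continuous.
  exact/is_cvg_wseries/norm_digit.
rewrite -(cvg_lim _ cv)//; apply: limr_le; first by apply/cvg_ex; eexists; exact: cv.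
apply: nearW => N; rewrite /series/= exchange_big/=.
rewrite -[leRHS]mulr1 -[X in _ * X](expr0 10^-1).
apply: le_trans (@norm_wseries_le (fun=> 1) 0 N _ _) => //; last first.
  by move=> j; rewrite normr1.
apply: ler_sum => j _; rewrite -mulr_sumr normrM normr1 mulr1.
rewrite ger0_norm ?weight_ge0// ler_piMr ?weight_ge0//.
have [jn|jn] := ltnP (e j) n; last first.
  rewrite big1// => i _; case: eqP => // ei.
  by move: (ltn_ord i); rewrite -ei ltnNge jn.
rewrite (bigD1 (Ordinal jn))//= eqxx big1 ?addr0// => i iej.
by case: eqP => // ei; move: iej; rewrite -(inj_eq val_inj)/= ei eqxx.
Qed.

Section agree.
Variables (e f : nat -> nat) (k : nat).
Hypothesis ef : forall j, (j < k)%N -> e j = f j.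

Let a (i : nat) (j : nat) : R := (e j == i)%:R - (f j == i)%:R.

Let a1 i j : `|a i j| <= 1.
Proof. by rewrite /a; do 2 case: eqP => _; rewrite ?subrr ?subr0 ?sub0r ?normrN ?normr0 ?normr1. Qed.

Let a0 i j : (j < k)%N -> a i j = 0.
Proof. by move=> /ef efj; rewrite /a efj subrr. Qed.

Lemma digit_pointB (i : 'I_n) :
  (digit_point e - digit_point f) ord0 i = wsum (a i).
Proof. by rewrite !mxE wsumB //; exact: norm_digit. Qed.

Lemma digit_point_close (i : 'I_n) :
  `|(digit_point e - digit_point f) ord0 i| <= 7 / 10 * 10^-1 ^+ k.
Proof. by rewrite digit_pointB; apply: norm_wsum_le => // j; exact: a0. Qed.

Lemma digit_point_lead (i : 'I_n) : e k != f k -> e k = i ->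
  56 / 100 * 10^-1 ^+ k <= (digit_point e - digit_point f) ord0 i.
Proof.
move=> efk eki; rewrite digit_pointB; apply: wsum_lead_ge => // [j|]; first exact: a0.
by rewrite /a -eki eqxx eq_sym (negbTE efk) subr0.
Qed.

End agree.

(** At the first differing rank the coordinates [e k] and [f k] receive leading terms of opposite
    signs. Each contributes at least [(56/100 * q)^2], and twice [(56/100)^2] exceeds [(3/4)^2]. *)
Lemma l2norm_digit_pointB_ge e f k : (forall j, (j < k)%N -> e j = f j) ->
  e k != f k -> (e k < n)%N -> (f k < n)%N ->
  3 / 4 * 10^-1 ^+ k <= l2norm (digit_point e - digit_point f).
Proof.
move=> ef efk ekn fkn; set q := 10^-1 ^+ k.
have q0 : 0 <= q by rewrite exprn_ge0//; lra.
have He : 56 / 100 * q <= (digit_point e - digit_point f) ord0 (Ordinal ekn).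
  exact: digit_point_lead.
have Hf : 56 / 100 * q <= (digit_point f - digit_point e) ord0 (Ordinal fkn).
  by apply: digit_point_lead => // [j jk|]; [rewrite ef|rewrite eq_sym].
rewrite -(@ler_pXn2r _ 2%N) ?nnegrE ?sqrtr_ge0 ?mulr_ge0//.
rewrite sqr_l2norm (bigD1 (Ordinal ekn))//= (bigD1 (Ordinal fkn))/=; last first.
  by rewrite -(inj_eq val_inj)/= eq_sym.
set w := (_ * q) ^+ 2; set x := _ ^+ 2; set y := _ ^+ 2; set z := \sum_(i < n | _) _.
have z0 : 0 <= z by apply: sumr_ge0 => i _; exact: sqr_ge0.
have sq u : 56 / 100 * q <= u -> (56 / 100 * q) ^+ 2 <= u ^+ 2.
  move=> qu; have q0' : 0 <= 56 / 100 * q by rewrite mulr_ge0//; lra.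
  by rewrite ler_pXn2r ?nnegrE// (le_trans q0').
have xq : (56 / 100 * q) ^+ 2 <= x by exact: sq He.
have yq : (56 / 100 * q) ^+ 2 <= y.
  by rewrite /y -[leRHS]sqrrN; apply: sq; apply: le_trans Hf _; rewrite !mxE opprB.
have q2 : 0 <= q ^+ 2 by exact: sqr_ge0.
move: xq yq; rewrite /w !exprMn; set q' := q ^+ 2 in q2 *; lra.
Qed.

End digit_points.

(** * Base-n digits of a uniform real number *)

Section digits.
Context (R : realType) (n : nat) (n0 : (0 < n)%N).
Implicit Types (s t : R) (j k : nat).

(** For [t] in [0, 1), the integer written by the first [k] base-[n] digits of [t]; its fibres are
    intervals of length [n^-k]. *)
Definition prefix k t : int := Num.floor (t * n%:R ^+ k).

Definition digit t j : nat := `|(prefix j.+1 t %% n)%Z|%N.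

Lemma digit_lt t j : (digit t j < n)%N.
Proof.
rewrite /digit -ltz_nat gez0_abs ?modz_ge0 ?ltz_pmod//.
by rewrite eqz_nat -lt0n.
Qed.

Lemma prefix_divz k t : (prefix k.+1 t %/ n)%Z = prefix k t.
Proof.
apply/esym/floor_def; set m := prefix k.+1 t.
have nR : (0 : R) < n%:R by rewrite ltr0n.
have mE := divz_eq m n.
have r0 : 0 <= (m %% n)%Z by rewrite modz_ge0// eqz_nat -lt0n.
have rn : (m %% n)%Z < n by rewrite ltz_pmod.
have tE : t * n%:R ^+ k.+1 = n%:R * (t * n%:R ^+ k) by rewrite exprS mulrCA.
have /andP[] : m%:~R <= n%:R * (t * n%:R ^+ k) < (m + 1)%:~R.
  by rewrite -tE; exact: floor_itv.
move=> mle mlt.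
apply/andP; split.
  rewrite -(ler_pM2l nR); apply: le_trans mle.
  rewrite -[n%:R]/((n : int)%:~R) -intrM ler_int.
  move: mE r0; move: (divz m n) (modz m n) => q r mE r0; nia.
rewrite -(ltr_pM2l nR); apply: lt_le_trans mlt _.
rewrite -[n%:R]/((n : int)%:~R) -intrM ler_int.
move: mE rn; move: (divz m n) (modz m n) => q r mE rn; nia.
Qed.

Lemma prefixS k t : prefix k.+1 t = prefix k t * n + (digit t k)%:Z.
Proof.
rewrite {1}(divz_eq (prefix k.+1 t) n) prefix_divz /digit gez0_abs//.
by rewrite modz_ge0// eqz_nat -lt0n.
Qed.

Lemma prefix_digit_eq k s t : prefix k s = prefix k t ->
  forall j, (j < k)%N -> digit s j = digit t j.
Proof.
elim: k => // k IHk pst j; rewrite ltnS leq_eqVlt => /predU1P[->|jk].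
  by rewrite /digit pst.
by apply: IHk => //; rewrite -(prefix_divz k s) -(prefix_divz k t) pst.
Qed.

(** The digits are remainders and do not see the integer part, which the range [0, 1) fixes to be
    0. *)
Lemma digit_prefix_eq k s t : 0 <= s < 1 -> 0 <= t < 1 ->
  (forall j, (j < k)%N -> digit s j = digit t j) -> prefix k s = prefix k t.
Proof.
move=> s01 t01; elim: k => [_|k IHk dst].
  have prefix0 u : 0 <= u < 1 -> prefix 0 u = 0.
    by move=> u01; rewrite /prefix expr0 mulr1; apply: floor_def.
  by rewrite !prefix0.
by rewrite !prefixS dst// IHk// => j jk; rewrite dst// ltnW.
Qed.

Lemma prefix_preimage1 k (m : int) :
  prefix k @^-1` [set m] = `[m%:~R / n%:R ^+ k, (m + 1)%:~R / n%:R ^+ k[%classic.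
Proof.
have nk : (0 : R) < n%:R ^+ k by rewrite exprn_gt0// ltr0n.
apply/seteqP; split => t /=; rewrite in_itv/= ler_pdivrMr// ltr_pdivlMr//.
  by move=> <-; exact: floor_itv.
exact: floor_def.
Qed.

Lemma measurable_prefix k (B : set int) : measurable (prefix k @^-1` B).
Proof.
have -> : prefix k @^-1` B =
    \bigcup_(m : int) (if m \in B then prefix k @^-1` [set m] else set0).
  apply/seteqP; split => [t Bt|t [m _]].
    by exists (prefix k t) => //; rewrite mem_set.
  by case: ifPn => // /set_mem Bm /= ->.
apply: countable_bigcupT_measurable => [|m]; first exact: countableP.
by case: ifP => // _; rewrite prefix_preimage1.
Qed.

Lemma measurable_cylinder k s :
  measurable [set t | forall j, (j < k)%N -> digit s j = digit t j].
Proof.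
have -> : [set t | forall j, (j < k)%N -> digit s j = digit t j] =
    \bigcap_(j in `I_k) (prefix j.+1 @^-1` [set m | digit s j = `|(m %% n)%Z|%N]).
  by apply/seteqP; split => t /= H j /= /H.
by apply: fin_bigcap_measurable => // j _; exact: measurable_prefix.
Qed.

Lemma uniform_prob01E (A : set (measurableTypeR R)) : measurable A ->
  uniform_prob (@ltr01 R) A = lebesgue_measure (A `&` `[0, 1]).
Proof.
move=> mA; rewrite /uniform_prob integral_uniform_pdf.
rewrite (eq_integral (cst 1%E)) ?integral_cst ?mul1e//; first exact: measurableI.
move=> t; rewrite inE => -[_]; rewrite /= in_itv/= /uniform_pdf => ->.
by rewrite subr0 invr1.
Qed.

(** Within [0, 1) the cylinder lies in a single fibre of [prefix k]. *)
Lemma uniform_cylinder_le k s : (uniform_prob (@ltr01 R)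
  [set t | forall j, (j < k)%N -> digit s j = digit t j] <= (n%:R ^- k)%:E)%E.
Proof.
rewrite uniform_prob01E; last exact: measurable_cylinder.
set A := [set t | _].
have [m Am] : exists m, A `&` `[0, 1[ `<=` prefix k @^-1` [set m].
  have [[u [Au u01]]|] := pselect (exists u, (A `&` `[0, 1[) u); last first.
    by move=> nA; exists 0 => t At; case: nA; exists t.
  exists (prefix k u) => t [At t01].
  apply: digit_prefix_eq => [||j jk].
  - by move: t01; rewrite /= in_itv.
  - by move: u01; rewrite /= in_itv.
  - by rewrite -(At j jk) -(Au j jk).
(* The uniform law lives on the closed interval; the endpoint 1, whose integer part is not 0, is set
   aside as a null set. *)
have sub : A `&` `[0, 1] `<=` prefix k @^-1` [set m] `|` [set 1].
  move=> t [At]; rewrite /= in_itv/= [t <= 1]le_eqVlt => /andP[t0 /predU1P[->|t1]].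
    by right.
  by left; apply: Am; split => //; rewrite /= in_itv/= t0.
have mpre : measurable (prefix k @^-1` [set m] : set (measurableTypeR R)).
  exact: measurable_prefix.
apply: (@le_trans _ _ (lebesgue_measure (prefix k @^-1` [set m] `|` [set 1]))).
  apply: le_measure => //; rewrite inE; last exact: measurableU.
  by apply: measurableI => //; exact: measurable_cylinder.
apply: le_trans; first exact: measureU2.
rewrite [X in (_ + X)%E]lebesgue_measure_set1 adde0 prefix_preimage1.
rewrite [leLHS]lebesgue_measure_itv/= lte_fin.
case: ifP => _; last by rewrite lee_fin invr_ge0 exprn_ge0.
by rewrite -EFinD lee_fin -mulrBl intrD addrAC subrr add0r div1r.
Qed.

Definition digit_rV t : 'rV[R]_n := digit_point R n (digit t).

(** Reals with the same [prefix k] have images within [10^-k] in every coordinate, so the preimage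
    of an open set is a countable union of preimages under the prefixes. *)
Lemma measurable_digit_rV :
  measurable_fun setT (digit_rV : measurableTypeR R -> borel_rV R n).
Proof.
apply: (@measurability _ _ (measurableTypeR R) (borel_rV R n) setT digit_rV
  (@open 'rV[R]_n)) => //.
move=> _ [U oU <-]; rewrite setTI.
have -> : digit_rV @^-1` U = \bigcup_k prefix k @^-1`
    [set m | forall t, prefix k t = m -> U (digit_rV t)].
  apply/seteqP; split => [t Ut|t [k _]]; last by apply.
  (* This [k] exceeds [e^-1], hence [10^-k < e]. The ball is one of the sup norm, so coordinatewise
     bounds suffice. *)
  move: oU; rewrite openE => /(_ _ Ut)/nbhs_ballP[e/= e0 eU].
  pose k := (Num.truncn e^-1).+1; exists k => //= u /prefix_digit_eq ut.
  apply: eU; split => // i j; rewrite ord1 /ball/=.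
  have := @digit_point_close R n _ _ k (fun j jk => esym (ut j jk)) j.
  rewrite !mxE => /le_lt_trans; apply.
  have ke : e^-1 < 10 ^+ k.
    apply: lt_trans (truncnS_gt _) _.
    by rewrite -natrX ltr_nat ltn_expl.
  rewrite exprVn; apply: (@le_lt_trans _ _ (10 ^+ k)^-1).
    by rewrite ler_piMl ?invr_ge0 ?exprn_ge0//; lra.
  by rewrite invf_plt ?posrE ?exprn_gt0.
apply: bigcupT_measurable => k; exact: measurable_prefix.
Qed.

End digits.

(** * Energy of the law of the random digit point *)

Section digit_energy.
Context (R : realType) (lambda : R) (lambda0 : 0 < lambda).
Context (n : nat) (n0 : (0 < n)%N).

Let C : R := (3 / 4) `^ (- lambda).
Let q : R := 10 `^ lambda.
Let P : probability (measurableTypeR R) R := uniform_prob (@ltr01 R).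
Let X := @digit_rV R n.

Let cylinder k (s : R) : set (measurableTypeR R) :=
  [set t | forall j, (j < k)%N -> digit n s j = digit n t j].

Let C_gt0 : 0 < C.
Proof. by rewrite powR_gt0//; lra. Qed.

Let q_ge0 : 0 <= q.
Proof. exact: powR_ge0. Qed.

Let Cq_ge0 k : 0 <= C * q ^+ k.
Proof. by rewrite mulr_ge0 ?exprn_ge0// ltW. Qed.

Lemma powR_scale k : (3 / 4 * 10^-1 ^+ k) `^ (- lambda) = C * q ^+ k.
Proof.
have -> : 10^-1 ^+ k = 10 `^ (- k%:R) :> R by rewrite powRN powR_mulrn// exprVn.
rewrite powRM ?powR_ge0//.
by rewrite -powRrM mulrNN (mulrC k%:R) powRrM powR_mulrn ?powR_ge0.
Qed.

(** If the digits first differ at rank [k], the term of rank [k] alone bounds the kernel. The other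
    terms are nonnegative, so nested cylinders can replace the disjoint events of a first difference
    at each rank. *)
Lemma riesz_kernel_digit_le (s t : R) : (riesz_kernel lambda (X s) (X t) <=
  \sum_(k <oo) (C * q ^+ k)%:E * (\1_(cylinder k s) t)%:E)%E.
Proof.
have term_ge0 k : (0 <= (C * q ^+ k)%:E * (\1_(cylinder k s) t)%:E)%E.
  by rewrite mule_ge0// lee_fin.
have [ex|same] := pselect (exists k, digit n s k != digit n t k).
  case: (ex_minnP ex) => k dk kmin.
  have agree j : (j < k)%N -> digit n s j = digit n t j.
    move=> jk; apply/eqP; apply: contraTT jk => /kmin.
    by rewrite leqNgt.
  apply: le_trans (nneseries_lim_ge k.+1 (fun k _ _ => term_ge0 k)).
  rewrite big_nat_recr//= indicE mem_set// mule1.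
  apply: le_trans (leeDr _ _); last by apply: sume_ge0.
  have dist := l2norm_digit_pointB_ge R agree dk (digit_lt n0 s k) (digit_lt n0 t k).
  have r0 : 0 < 3 / 4 * 10^-1 ^+ k :> R.
    by rewrite mulr_gt0 ?exprn_gt0// ?invr_gt0//; lra.
  have d0 : 0 < l2norm (X s - X t) := lt_le_trans r0 dist.
  have Xst : X s != X t by rewrite -subr_eq0 -l2norm_eq0 gt_eqF.
  rewrite /riesz_kernel (negbTE Xst) -powR_scale lee_fin !powRN.
  rewrite lef_pV2 ?posrE ?powR_gt0//.
  by apply: ge0_ler_powR => //; rewrite ?nnegrE; exact: ltW.
have tcyl k : \1_(cylinder k s) t = 1 :> R.
  rewrite indicE mem_set// => j _; apply/eqP; apply/negPn/negP => dj.
  by apply: same; exists j.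
(* When all digits agree the kernel is infinite, but so is the series: each of its terms is at least
   [C]. *)
rewrite (_ : (\sum_(_ <oo) _)%E = +oo%E) ?leey//.
apply/eqyP => A A0; pose N := (Num.truncn (A / C)).+1.
apply: le_trans (nneseries_lim_ge N (fun k _ _ => term_ge0 k)).
under eq_bigr do rewrite tcyl mule1.
rewrite sumEFin lee_fin; apply: (@le_trans _ _ (\sum_(0 <= k < N) C)).
  rewrite big_const_nat subn0 iter_addr_0 -mulr_natr mulrC -ler_pdivrMr//.
  exact/ltW/truncnS_gt.
apply: ler_sum => k _; rewrite ler_peMr ?(ltW C_gt0)// exprn_ege1//.
by rewrite -[leLHS](powRr0 10) ler_powR ?ltW ?ltr1n.
Qed.

Lemma geometric_sum_le N : q < n%:R ->
  \sum_(0 <= k < N) C * (q / n%:R) ^+ k <= C / (1 - q / n%:R).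
Proof.
move=> qn; set z := q / n%:R.
have z0 : 0 <= z by rewrite divr_ge0.
have z1 : 0 < 1 - z by rewrite subr_gt0 ltr_pdivrMr ?mul1r ?ltr0n.
rewrite -mulr_sumr ler_wpM2l ?(ltW C_gt0)// -[leRHS]mul1r ler_pdivlMr//.
rewrite big_mkord mulrC -opprB mulNr -subrX1 opprB gerBl; exact: exprn_ge0.
Qed.

(** Integrated term by term, the series is dominated by a geometric one: the kernel bound grows by
    [q] per rank while the cylinders shrink by [n]. *)
Lemma digit_potential_le (s : R) : q < n%:R ->
  (\int[P]_t riesz_kernel lambda (X s) (X t) <= (C / (1 - q / n%:R))%:E)%E.
Proof.
move=> qn; have mcyl k : measurable (cylinder k s) by exact: measurable_cylinder.
refine (le_trans (@le_integral_setT _ (measurableTypeR R) R P _ _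
  (riesz_kernel_digit_le s)) _).
rewrite integral_nneseries//; last 2 first.
- move=> k; apply/measurable_EFinP; apply: measurable_funM => //.
- by move=> k t _; rewrite mule_ge0// lee_fin.
apply: lime_le.
  apply: is_cvg_nneseries => k _ _; apply: integral_ge0 => t _.
  by rewrite mule_ge0// lee_fin.
apply: nearW => N; apply: le_trans (_ : (_ <= (\sum_(0 <= k < N) C * (q / n%:R) ^+ k)%:E)%E) _; last first.
  by rewrite lee_fin geometric_sum_le.
rewrite -sumEFin; apply: lee_sum => k _.
rewrite ge0_integralZl ?lee_fin//=; last exact/measurable_EFinP.
rewrite integral_indic// setIT.
apply: (@le_trans _ _ ((C * q ^+ k)%:E * (n%:R ^- k)%:E)%E).
  by rewrite lee_wpmul2l ?lee_fin//; exact: uniform_cylinder_le.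
by rewrite lee_fin expr_div_n mulrA.
Qed.

Lemma digit_measure : q < n%:R ->
  exists2 nu : probability (borel_rV R n) R,
    msupport nu `<=` [set x | (forall i, 0 <= x ord0 i) /\ \sum_(i < n) x ord0 i <= 7 / 10] &
    (riesz_energy lambda nu <= (C / (1 - q / n%:R))%:E)%E.
Proof.
move=> qn.
pose X' : {mfun measurableTypeR R >-> borel_rV R n} :=
  HB.pack (X : measurableTypeR R -> borel_rV R n)
    (isMeasurableFun.Build _ _ _ _ _ (measurable_digit_rV n0)).
exists (distribution P X').
  move=> x xsupp.
  (* An open set that [X] never meets is null, hence misses the support; this applies to the strict
     violation of each constraint. *)
  have avoid (U : set 'rV[R]_n) : open U -> (forall t, ~ U (X t)) -> ~ U x.
    move=> oU UX Ux; have : (0 < P (X @^-1` U))%E := xsupp U oU Ux.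
    by rewrite (_ : X @^-1` U = set0) ?measure0 ?ltxx// -subset0 => t /UX.
  split=> [i|]; rewrite leNgt; apply/negP.
    apply: (avoid [set y | y ord0 i < 0]) => [|t]; last first.
      by apply/negP; rewrite -leNgt digit_point_ge0.
    apply: (@open_comp _ _ (fun y : 'rV[R]_n => y ord0 i) [set u | u < 0]).
      by move=> y _; exact: coord_continuous.
    exact: open_lt.
  apply: (avoid [set y | 7 / 10 < \sum_(i < n) y ord0 i]) => [|t]; last first.
    by apply/negP; rewrite -leNgt digit_point_sum_le.
  apply: (@open_comp _ _ (fun y : 'rV[R]_n => \sum_(i < n) y ord0 i)
    [set u | 7 / 10 < u]).
    by move=> y _; apply: (@continuous_coord_sum _ _ id) => u; exact: cvg_id.
  exact: open_gt.
(* The pushforward inequality is used twice, here for the outer integral and at the end for the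
   inner one. *)
rewrite /riesz_energy; apply: le_trans (pushforward_integral_le _ _ _) _.
  by move=> x; apply: integral_ge0 => y _; exact: riesz_kernel_ge0.
apply: (@le_trans _ _ (\int[P]_s (C / (1 - q / n%:R))%:E)%E); last first.
  by rewrite integral_cst// [X in (_ * X)%E](probability_setT P) mule1.
apply: le_integral_setT => s; apply: le_trans (digit_potential_le s qn).
by apply: pushforward_integral_le => y; exact: riesz_kernel_ge0.
Qed.

End digit_energy.

(** * Diameter of the simplex and comparison of capacities *)

(** For nonnegative coordinates the cross term only decreases the squared distance, and each squared
    norm is at most 7/10 times the coordinate sum, so the total is at most 98/100. *)
Lemma diam_simplex_le (R : realType) (n : nat) (A : set 'rV[R]_n) :
  A `<=` [set x | (forall i, 0 <= x ord0 i) /\ \sum_(i < n) x ord0 i <= 7 / 10] ->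
  (diam A <= 1)%E.
Proof.
move=> sA; apply: ge_ereal_sup => _ [x /sA[x0 xs] [y /sA[y0 ys] <-]].
have sqr_sum_le (z : 'rV[R]_n) : (forall i, 0 <= z ord0 i) ->
    \sum_(i < n) z ord0 i <= 7 / 10 -> \sum_(i < n) z ord0 i ^+ 2 <= 49 / 100.
  move=> z0 zs; apply: (@le_trans _ _ (\sum_(i < n) z ord0 i * (7 / 10))).
    apply: ler_sum => i _; rewrite expr2 ler_wpM2l//; apply: le_trans zs.
    by rewrite (bigD1 i)//= lerDl sumr_ge0.
  rewrite -mulr_suml; lra.
rewrite lee_fin -(@ler_pXn2r _ 2%N) ?nnegrE ?sqrtr_ge0// sqr_l2norm expr1n.
apply: (@le_trans _ _ (\sum_(i < n) (x ord0 i ^+ 2 + y ord0 i ^+ 2))).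
  apply: ler_sum => i _; rewrite !mxE; have := mulr_ge0 (x0 i) (y0 i).
  set u := x _ _; set v := y _ _; nra.
rewrite big_split/=; have := sqr_sum_le _ x0 xs; have := sqr_sum_le _ y0 ys; lra.
Qed.

Theorem theorem4 (R : realType) (lambda : R) (hlambda : 0 < lambda) :
  exists N : nat, forall n : nat, (N <= n)%N -> lambda < n%:R ->
    (ereal_sup [set capacity lambda A |
        A in [set A : set 'rV[R]_n | (diam A <= 1)%E]]
      > capacity lambda (l2ball n 2^-1))%E.
Proof.
set C : R := (3 / 4) `^ (- lambda); set q : R := 10 `^ lambda.
set D : R := 2 `^ (lambda / 2).
have C0 : 0 < C by rewrite powR_gt0//; lra.
have q0 : 0 < q by rewrite powR_gt0.
have CD : C < D.
  have sqrt2 : 4 / 3 < 2 `^ 2^-1 :> R.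
    rewrite powR12_sqrt// -(@ltr_pXn2r _ 2%N) ?nnegrE ?sqrtr_ge0//.
    rewrite sqr_sqrtr//; lra.
  rewrite /C /D (_ : 3 / 4 = (4 / 3) `^ (- 1)); last by rewrite powR_inv1// invf_div.
  rewrite -powRrM mulrNN mul1r (mulrC lambda) powRrM.
  by apply: gt0_ltr_powR => //; rewrite nnegrE ?powR_ge0//; lra.
(* Chosen so that [q / n < 1 - C / D], which is equivalent to [C / (1 - q / n) < D]. *)
pose N := (Num.truncn (q / (1 - C / D))).+1.
exists N => n Nn _.
have n0 : (0 < n)%N by exact: leq_trans Nn.
have D0 : 0 < D by exact: lt_trans CD.
have CD1 : 0 < 1 - C / D by rewrite subr_gt0 ltr_pdivrMr ?mul1r.
have qn : q / n%:R < 1 - C / D.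
  rewrite ltr_pdivrMr ?ltr0n// mulrC -ltr_pdivrMr//.
  by apply: lt_le_trans (truncnS_gt _) _; rewrite ler_nat.
have qn1 : q < n%:R.
  rewrite -[ltRHS]mul1r -ltr_pdivrMr ?ltr0n//.
  by have := divr_gt0 C0 D0; lra.
have [nu supp_nu nuE] := digit_measure hlambda n0 qn1.
(* The competing set is the support of [nu] itself, for which [nu] is trivially admissible. *)
apply: (@lt_le_trans _ _ (capacity lambda (msupport nu))); last first.
  by apply: ereal_sup_ubound; exists (msupport nu) => //=; exact: diam_simplex_le.
(* Inversion reverses the order on nonnegative extended reals, so both infima must be known to be
   nonnegative. *)
have energy_ge0 A : (0 <= ereal_inf [set riesz_energy lambda nu |
    nu in [set nu : probability (borel_rV R n) R | msupport nu `<=` A]])%E.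
  apply: le_ereal_inf_tmp => _ [mu _ <-]; apply: integral_ge0 => x _.
  by apply: integral_ge0 => y _; exact: riesz_kernel_ge0.
rewrite /capacity lte_pV2 ?inE//.
apply: (@lt_le_trans _ _ D%:E); last first.
  by apply: le_ereal_inf_tmp => _ [mu smu <-]; exact: ball_energy_ge.
apply: le_lt_trans (_ : (_ <= (C / (1 - q / n%:R))%:E)%E) _.
  apply: le_trans nuE; apply: ereal_inf_lbound; exists nu => //.
rewrite lte_fin ltr_pdivrMr; last by rewrite subr_gt0 ltr_pdivrMr ?mul1r ?ltr0n.
have : C / D < 1 - q / n%:R by lra.
by rewrite ltr_pdivrMr// mulrC.
Qed.
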